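(* Let $n\in\mathbb N$, $n\ge3$, be odd and let $$E_1=\begin{pmatrix}1&-\frac{\cos(\phi_n/2)}{\sin(\phi_n/2)}\\-\frac{\cos(\phi_n/2)}{\sin(\phi_n/2)}&-1\end{pmatrix},\quad \phi_n=\frac{n-2}{n}\pi,\qquad K=\{RE_1R^T:\ R\in\hat{\mathcal P}_n\}.$$ Then the single layer geometrically linear Conti construction $v_0$ (defined in the context) uses exactly $n$ different strains, i.e. the symmetrised gradients $e(\nabla v_0)|_{T_j}$, $j=1,\dots,2n$, take exactly $n$ distinct values. More generally, the set of linearised energy wells $K$ consists of exactly $n$ different elements, i.e. $\#K=n$.
   Context: $e(M)=\frac12(M+M^T)$. $\hat{\mathcal P}_n=\hat{\mathcal R}_1^n\cup\hat{\mathcal R}_2^n\subset O(2)$ is the standard dihedral group: $\hat{\mathcal R}_1^n$ is the set of rotation matrices by angles $\frac{2\pi j}{n}$, $j=0,\dots,n-1$, and $\hat{\mathcal R}_2^n=\mathrm{diag}(1,-1)\,\hat{\mathcal R}_1^n$. Single layer linear construction $v_0$: $\{e_1,e_2\}$ is the standard basis of $\mathbb R^2$, $Q_s$ is the counterclockwise rotation by angle $\frac{2\pi}{n}s$, $e^\perp=$ counterclockwise rotation of $e$ by $\pi/2$. For $\alpha\in(0,1)$ set $r_I=\frac{1}{\cos(\pi/n)}\bigl(\cos(\frac{\pi}{n}(1-2\alpha))-\sqrt{\sin(\frac{2\pi}{n}\alpha)\sin(\frac{2\pi}{n}(1-\alpha))}\bigr)$, $a=\sqrt{\sin(\frac{2\pi}{n}(1-\alpha))/\sin(\frac{2\pi}{n}\alpha)}$.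 Let $E_i^{pt}=Q_{i-1}e_1$, $I_i=r_IQ_{i-1+\alpha}e_1$ ($i=1,\dots,n$; $E^{pt}_{n+1}=E^{pt}_1$, $I_0=I_n$), with convex hulls $\Omega_n^E$, $\Omega_n^I$. $T_j$ ($1\le j\le2n$) is the open triangle with vertices $E^{pt}_{(j+1)/2},I_{(j-1)/2},I_{(j+1)/2}$ ($j$ odd) or $E^{pt}_{j/2},I_{j/2},E^{pt}_{1+j/2}$ ($j$ even). Let $e_{11}=\frac{I_1-E^{pt}_1}{|I_1-E^{pt}_1|}$, $P_0=e_{11}\otimes e_{11}-e_{11}^\perp\otimes e_{11}^\perp$, $U=a\,e_{11}\otimes e_{11}+a^{-1}e_{11}^\perp\otimes e_{11}^\perp+\frac{a^{-1}-a}{\tan(\phi_n/2)}e_{11}\otimes e_{11}^\perp$. Let $U_j(\alpha)=Q_{\frac{j-1}{2}}UQ_{\frac{j-1}{2}}^T$ ($j$ odd), $U_j(\alpha)=Q_{\frac{j-2}{2}}P_0UP_0Q_{\frac{j-2}{2}}^T$ ($j$ even). Let $u_\alpha\in W^{1,\infty}_{loc}(\mathbb R^2;\mathbb R^2)$ be the map with $u_\alpha(x)=x$ outside $\Omega_n^E$, $u_\alpha(x)=Q_{1-2\alpha}x$ in $\Omega_n^I$, and $\nabla u_\alpha=R_E^TU_j(\alpha)$ on $T_j$ for a suitable $R_E=R_E(\alpha)\in SO(2)$. Then $v_0=\frac{d}{d\alpha}u_\alpha|_{\alpha=1/2}$, which is continuous and affine on each triangle $T_j$ taken at $\alpha=\frac12$,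 with $e(\nabla v_0)|_{T_j}=\frac{d}{d\alpha}[e(U_j(\alpha))]|_{\alpha=1/2}$. (The matrix $E_1$ in the claim represents, up to a non-zero scalar factor, $e(\nabla v_0)|_{T_1}$ in the basis $(e_{11},e_{11}^\perp)|_{\alpha=1/2}$.) *)

(* Defs.v *)
From HB Require Import structures.
From mathcomp Require Import all_boot all_order all_algebra.
From mathcomp Require Import all_classical all_reals all_analysis.
Import Order.TTheory GRing.Theory Num.Theory.
Import numFieldNormedType.Exports.

Set Implicit Arguments.
Unset Strict Implicit.
Unset Printing Implicit Defensive.

Local Open Scope classical_set_scope.
Local Open Scope ring_scope.

Section Plane.
Variable R : realType.
Implicit Types (v w x A B C : 'cV[R]_2) (M : 'M[R]_2).

Definition mx22 (a b c d : R) : 'M[R]_2 :=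
  \matrix_(i, j) if i == 0 then (if j == 0 then a else b)
                 else (if j == 0 then c else d).

Definition e1 : 'cV[R]_2 := delta_mx 0 0.

Definition rotation (theta : R) : 'M[R]_2 :=
  mx22 (cos theta) (- sin theta) (sin theta) (cos theta).

Definition perp v : 'cV[R]_2 := rotation (pi / 2) *m v.

Definition tensor v w : 'M[R]_2 := v *m w^T.

(* The library norm on matrices is the sup norm, hence this definition. *)
Definition norm2 v : R := Num.sqrt (\sum_i v i 0 ^+ 2).

Definition sym M : 'M[R]_2 := 2^-1 *: (M + M^T).

Definition SO2 : set 'M[R]_2 := [set M | M *m M^T = 1%:M /\ \det M = 1].

(* (grad f x) i j is the partial derivative of f_i in direction e_j. *)
Definition grad (f : 'cV[R]_2 -> 'cV[R]_2) x : 'M[R]_2 :=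
  \matrix_(i, j) ('D_(delta_mx j 0) f x) i 0.

Definition convex_hull m (p : 'I_m -> 'cV[R]_2) : set 'cV[R]_2 :=
  [set x | exists w : 'I_m -> R,
    [/\ forall i, 0 <= w i, \sum_i w i = 1 & x = \sum_i w i *: p i]].

Definition open_triangle A B C : set 'cV[R]_2 :=
  [set x | exists a b c : R,
    [/\ 0 < a, 0 < b, 0 < c, a + b + c = 1 & x = a *: A + b *: B + c *: C]].

(* The continuous representatives of the elements of W^{1,oo}_loc(R^2; R^2)
   are exactly the locally Lipschitz maps. *)
Definition locally_lipschitz (f : 'cV[R]_2 -> 'cV[R]_2) : Prop :=
  forall x, exists2 V, nbhs x V & [lipschitz f y | y in V].

End Plane.

Section Conti.
Variables (R : realType) (n : nat).
Implicit Types (alpha s : R) (i j : nat).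

Definition Q s : 'M[R]_2 := rotation (2 * pi / n%:R * s).

Definition phi : R := (n%:R - 2) / n%:R * pi.

Definition r_I alpha : R :=
  (cos (pi / n%:R * (1 - 2 * alpha))
   - Num.sqrt (sin (2 * pi / n%:R * alpha) * sin (2 * pi / n%:R * (1 - alpha))))
  / cos (pi / n%:R).

Definition stretch alpha : R :=
  Num.sqrt (sin (2 * pi / n%:R * (1 - alpha)) / sin (2 * pi / n%:R * alpha)).

(* Both families are n-periodic in i, so that E_(n+1) = E_1 and I_0 = I_n. *)
Definition E_pt i : 'cV[R]_2 := Q (i%:R - 1) *m e1 R.
Definition I_pt alpha i : 'cV[R]_2 :=
  r_I alpha *: (Q (i%:R - 1 + alpha) *m e1 R).

Definition Omega_E : set 'cV[R]_2 := convex_hull (fun k : 'I_n => E_pt k.+1).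
Definition Omega_I alpha : set 'cV[R]_2 :=
  convex_hull (fun k : 'I_n => I_pt alpha k.+1).

Definition T alpha j : set 'cV[R]_2 :=
  if odd j then
    open_triangle (E_pt j.+1./2) (I_pt alpha j.-1./2) (I_pt alpha j.+1./2)
  else open_triangle (E_pt j./2) (I_pt alpha j./2) (E_pt (1 + j./2)).

Definition e11 alpha : 'cV[R]_2 :=
  let d := I_pt alpha 1 - E_pt 1 in (norm2 d)^-1 *: d.

Definition P0 alpha : 'M[R]_2 :=
  let e := e11 alpha in tensor e e - tensor (perp e) (perp e).

Definition U alpha : 'M[R]_2 :=
  let e := e11 alpha in let a := stretch alpha in
  a *: tensor e e + a^-1 *: tensor (perp e) (perp e)
  + ((a^-1 - a) / tan (phi / 2)) *: tensor e (perp e).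

Definition U_ alpha j : 'M[R]_2 :=
  if odd j then
    let q := Q (j.-1./2)%:R in q *m U alpha *m q^T
  else
    let q := Q (j.-2./2)%:R in
    q *m P0 alpha *m U alpha *m P0 alpha *m q^T.

Definition is_conti_map alpha (f : 'cV[R]_2 -> 'cV[R]_2) : Prop :=
  [/\ locally_lipschitz f,
      forall x, ~ Omega_E x -> f x = x,
      forall x, Omega_I alpha x -> f x = Q (1 - 2 * alpha) *m x
    & exists2 R_E, SO2 R_E &
        forall j, (1 <= j <= n.*2)%N -> forall x, T alpha j x ->
          differentiable f x /\ grad f x = R_E^T *m U_ alpha j].

Definition dihedral : set 'M[R]_2 :=
  let rotations :=
    [set rotation (2 * pi * j%:R / n%:R) | j in [set j | (j < n)%N]] in
  rotations `|` [set mx22 1 0 0 (-1) *m M | M in rotations].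

Definition E1 : 'M[R]_2 :=
  let c := cos (phi / 2) / sin (phi / 2) in mx22 1 (- c) (- c) (-1).

Definition K : set 'M[R]_2 := [set M *m E1 *m M^T | M in dihedral].

End Conti.

Definition v0 (R : realType) (u : R -> 'cV[R]_2 -> 'cV[R]_2) (x : 'cV[R]_2) :
    'cV[R]_2 :=
  derive1 (fun alpha => u alpha x) (1 / 2).

(* Main.v *)
Require Import Defs.
From mathcomp Require Import all_boot all_order all_algebra.
From mathcomp Require Import all_classical all_reals all_analysis.
From mathcomp Require Import ring lra zify.
Import Order.TTheory GRing.Theory Num.Theory.
Import numFieldNormedType.Exports.
Local Open Scope classical_set_scope.
Local Open Scope card_scope.
Local Open Scope ring_scope.

(** Write h = pi / n.  A trace-free symmetric 2 x 2 matrix is a multiple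
    [a *: reflection t] of the reflection matrix of angle t, and conjugating it
    by the rotation of angle x turns t into t + 2 x ([conj_rotation_reflection]).
    Both sets of strains turn out to be of the form

      { a *: reflection (t + 2 h m) : m = 0, ..., n - 1 },   a != 0,

    and such a set has exactly n elements because the angles are distinct in an
    interval shorter than a full turn ([reflection_orbit_card]).

    For the wells, E_1 is (cos h)^-1 *: reflection (- h).  Rotations add even
    multiples of 2 h to the angle, which exhausts all multiples modulo 2 pi as n
    is odd; the flip maps - h + 2 h (2 k) to - h + 2 h (1 - 2 k), so it gives
    nothing new ([K_orbit]).

    For the construction, u_alpha is affine on each triangle T_j, since its
    gradient is constant there, and continuous up to the vertices
    ([affine_on_triangle]).  Hence it is the affine interpolation of its values
    at the vertices, and these are known: it fixes the outer vertices E_i and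
    rotates the inner vertices I_i by the angle - 4 h (alpha - 1/2).  As
    u_(1/2) is the identity, differentiating in alpha at 1/2 kills the
    contribution of the moving barycentric coordinates, and v_0 on T_j is the
    affine interpolation of the vectors k_V V^perp, where k_V is the angular
    velocity 0 or - 4 h of the vertex V ([interpolation_velocity]).  At
    alpha = 1/2 the triangle T_j is isosceles, its axis has angle h (j - 1), and
    both vertices of its base have the same angular velocity.  Subtracting the
    corresponding infinitesimal rotation leaves a simple shear along the
    axis, whose symmetric part is a multiple of the reflection of angle
    pi/2 + 2 h (j - 1) ([isosceles_strain]).  The value of r_I at 1/2 makes the
    multiple equal to 2 h / sin h for both kinds of triangles
    ([conti_strain]), so the 2 n strains run twice through one orbit. *)

(** * Matrices of size two *)

Lemma cv2P (T : Type) (v w : 'cV[T]_2) : v 0 0 = w 0 0 -> v 1 0 = w 1 0 -> v = w.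
Proof.
move=> vw0 vw1; apply/colP => i; case: (unliftP 0 i) => [k|] -> //.
by rewrite (ord1 k) (_ : lift 0 0 = 1) //; apply/val_inj.
Qed.

Lemma mulmx2E (A : pzSemiRingType) m p (M : 'M[A]_(m, 2)) (N : 'M[A]_(2, p)) i j :
  (M *m N) i j = M i 0 * N 0 j + M i 1 * N 1 j.
Proof.
rewrite mxE !big_ord_recl big_ord0 addr0 (_ : lift 0 0 = 1) //.
exact/val_inj.
Qed.

Lemma mx2P (A : Type) (M N : 'M[A]_2) :
  M 0 0 = N 0 0 -> M 0 1 = N 0 1 -> M 1 0 = N 1 0 -> M 1 1 = N 1 1 -> M = N.
Proof.
move=> e00 e01 e10 e11; apply/matrixP => i j.
by case: (unliftP 0 i) => [k|] ->; case: (unliftP 0 j) => [l|] ->;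
  rewrite ?(ord1 k) ?(ord1 l) // (_ : lift 0 0 = 1) //; apply/val_inj.
Qed.

(** * Trace-free symmetric matrices and the wells *)

Section Wells.
Context {R : realType}.
Implicit Types (a t x : R).

Lemma cosD2pin t k : cos (t + 2 * pi * k%:R) = cos t.
Proof.
by rewrite mulr_natr (_ : 2 * pi = pi *+ 2 :> R) ?mulr_natl //
  (periodicn (@cosD2pi R)).
Qed.

Lemma sinD2pin t k : sin (t + 2 * pi * k%:R) = sin t.
Proof.
by rewrite mulr_natr (_ : 2 * pi = pi *+ 2 :> R) ?mulr_natl //
  (periodicn (@sinD2pi R)).
Qed.

Definition reflection t : 'M[R]_2 := mx22 (cos t) (sin t) (sin t) (- cos t).

Lemma reflectionD2pin t k : reflection (t + 2 * pi * k%:R) = reflection t.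
Proof. by rewrite /reflection cosD2pin sinD2pin. Qed.

Lemma conj_rotation_reflection a t x :
  rotation x *m (a *: reflection t) *m (rotation x)^T
  = a *: reflection (t + 2 * x).
Proof.
have xx := cos2Dsin2 x.
have -> : t + 2 * x = t + x + x by ring.
apply: mx2P; rewrite !(mulmx2E, mxE) /=; rewrite !(cosD, sinD); ring: xx.
Qed.

Lemma conj_flip_reflection a t :
  mx22 1 0 0 (-1) *m (a *: reflection t) *m (mx22 1 0 0 (-1))^T
  = a *: reflection (- t).
Proof. by apply: mx2P; rewrite !(mulmx2E, mxE) /= ?cosN ?sinN; ring. Qed.

Lemma cos_eq1 t : 0 <= t < 2 * pi -> cos t = 1 -> t = 0.
Proof.
move=> /andP[t0 t2pi] ct; apply/eqP; rewrite eq_le t0 andbT leNgt.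
apply/negP => tp.
have : 0 < sin (t / 2) by apply: sin_gt0_pi; lra.
have := cos_mulr2n (t / 2); rewrite (_ : t / 2 *+ 2 = t); last by field.
rewrite cos2sin2 ct => e; have : sin (t / 2) ^+ 2 = 0 by lra.
by move/eqP; rewrite expf_eq0 /= => /eqP ->; rewrite ltxx.
Qed.

(** The scalar product of the unit vectors of angles t and t' is cos (t' - t),
    which is 1 only when the angles agree. *)
Lemma reflection_inj_period t t' : t <= t' < t + 2 * pi ->
  reflection t = reflection t' -> t = t'.
Proof.
move=> /andP[tt' t'2pi] /matrixP e.
have := e 0 1; have := e 0 0; rewrite !mxE /= => ec es.
suff : t' - t = 0 by lra.
apply: cos_eq1; first by lra.
by rewrite cosB ec es -!expr2 cos2Dsin2.
Qed.

Lemma reflection_orbit_card (n : nat) a t : (0 < n)%N -> a != 0 ->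
  [set a *: reflection (t + 2 * pi / n%:R * m%:R) | m in `I_n] #= `I_n.
Proof.
move=> n0 a0; have n0' : 0 < n%:R :> R by rewrite ltr0n.
have p0 := pi_gt0 R.
have lt_inj (m m' : nat) : (m <= m')%N -> (m' < n)%N ->
    a *: reflection (t + 2 * pi / n%:R * m%:R)
    = a *: reflection (t + 2 * pi / n%:R * m'%:R) -> m = m'.
  move=> mm' m'n /(scalerI a0) /reflection_inj_period e.
  have d0 : 0 < 2 * pi / n%:R :> R by rewrite !mulr_gt0 ?invr_gt0.
  suff /addrI/(mulfI (lt0r_neq0 d0))/eqP : t + 2 * pi / n%:R * m%:R
      = t + 2 * pi / n%:R * m'%:R by rewrite eqr_nat => /eqP.
  apply: e; rewrite lerD2l (ler_pM2l d0) ler_nat mm' /= -addrA ltrD2l.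
  rewrite [ltRHS](_ : _ = 2 * pi / n%:R * (m%:R + n%:R)).
    by rewrite (ltr_pM2l d0) -natrD ltr_nat ltn_addl.
  by field; rewrite gt_eqF.
apply: inj_card_eq => m m'; rewrite !inE => mn m'n e.
by have [mm'|/ltnW mm'] := leqP m m'; [|symmetry];
  apply: lt_inj => //; rewrite e.
Qed.

Lemma reflection_modn (n m : nat) t : (0 < n)%N ->
  reflection (t + 2 * pi / n%:R * (m %% n)%:R)
  = reflection (t + 2 * pi / n%:R * m%:R).
Proof.
move=> n0; rewrite {2}(divn_eq m n) -(reflectionD2pin _ (m %/ n)).
congr reflection; rewrite natrD natrM; field.
by rewrite pnatr_eq0 -lt0n.
Qed.

Lemma phi_half (n : nat) : (0 < n)%N -> phi R n / 2 = pi / 2 - pi / n%:R.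
Proof. by move=> n0; rewrite /phi; field; rewrite pnatr_eq0 -lt0n. Qed.

Lemma pi_over_n_bounds (n : nat) : (3 <= n)%N -> 0 < (pi : R) / n%:R < pi / 2.
Proof.
move=> n3; have p0 := pi_gt0 R; rewrite divr_gt0 //= ?ltr0n ?(leq_trans _ n3)//.
by rewrite ltr_pM2l // ltf_pV2 ?posrE ?ltr0n ?ltr_nat ?(leq_trans _ n3).
Qed.

Lemma cos_pi_over_n_gt0 (n : nat) : (3 <= n)%N -> 0 < cos ((pi : R) / n%:R).
Proof. by move=> /pi_over_n_bounds b; apply: cos_gt0_pihalf; lra. Qed.

Lemma sin_pi_over_n_gt0 (n : nat) : (3 <= n)%N -> 0 < sin ((pi : R) / n%:R).
Proof. by move=> /pi_over_n_bounds b; apply: sin_gt0_pi; lra. Qed.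

Lemma E1_reflection (n : nat) : (3 <= n)%N ->
  E1 R n = (cos (pi / n%:R))^-1 *: reflection (- (pi / n%:R)).
Proof.
move=> n3; have c0 := lt0r_neq0 (cos_pi_over_n_gt0 n n3).
rewrite /E1 phi_half ?(leq_trans _ n3)// -[pi / 2 - _]opprB cosN sinN.
rewrite cosBpihalf sinBpihalf opprK.
by apply: mx2P; rewrite !mxE /= ?cosN ?sinN; field.
Qed.

(** Rotations alone already give the whole orbit: for odd m the even number
    m + n takes the place of m. *)
Lemma K_orbit (n : nat) : (3 <= n)%N -> odd n ->
  K n = [set (cos (pi / n%:R))^-1
               *: reflection (- (pi / n%:R) + 2 * pi / n%:R * m%:R)
        | m in `I_n].
Proof.
move=> n3 n_odd; have n0 : (0 < n)%N by exact: leq_trans n3.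
have n0' : n%:R != 0 :> R by rewrite pnatr_eq0 -lt0n.
set a := (cos (pi / n%:R))^-1; set t := - (pi / n%:R).
have orbit m : [set a *: reflection (t + 2 * pi / n%:R * m%:R) | m in `I_n]
    (a *: reflection (t + 2 * pi / n%:R * m%:R)).
  by exists (m %% n)%N; rewrite /= ?ltn_mod // reflection_modn.
have rot k : rotation (2 * pi * k%:R / n%:R) *m E1 R n
    *m (rotation (2 * pi * k%:R / n%:R))^T
    = a *: reflection (t + 2 * pi / n%:R * k.*2%:R).
  rewrite E1_reflection // conj_rotation_reflection; congr (_ *: reflection _).
  by rewrite -muln2 natrM /t; field.
apply/seteqP; split=> M.
  move=> [N [[k kn <-]|[_ [k kn <-] <-]] <-]; first by rewrite rot.
  rewrite trmx_mul -!mulmxA [X in _ *m X](_ : _ =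
    (a *: reflection (t + 2 * pi / n%:R * k.*2%:R)) *m (mx22 1 0 0 (-1))^T);
    last by rewrite -rot !mulmxA.
  rewrite mulmxA conj_flip_reflection.
  (* the flip sends the multiple 2 k of 2 pi / n to 1 - 2 k, which is
     congruent to 1 + 2 (n - k) modulo n *)
  suff -> : reflection (- (t + 2 * pi / n%:R * k.*2%:R))
    = reflection (t + 2 * pi / n%:R * ((n - k).*2.+1)%:R) by exact: orbit.
  rewrite -(reflectionD2pin _ 2); congr reflection.
  by rewrite -(natr1 (n - k).*2) -!muln2 !natrM natrB ?(ltnW kn) // /t; field.
move=> [m mn <-].
pose k := (if odd m then (m + n)./2 else m./2)%N.
have kn : (k < n)%N by move: (mn : (m < n)%N); rewrite /k; case: ifP; lia.
have km : (k.*2 %% n = m)%N.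
  move: (mn : (m < n)%N); rewrite /k; case: ifP => om mn'.
    rewrite even_halfK; last by rewrite oddD om n_odd.
    by rewrite modnDr modn_small.
  by rewrite even_halfK ?om // modn_small.
exists (rotation (2 * pi * k%:R / n%:R)); first by left; exists k.
by rewrite rot -reflection_modn // km.
Qed.

End Wells.

(** * Maps with constant gradient on a triangle *)

Section Triangles.
Context {R : realType}.
Implicit Types (v w x y A B C : 'cV[R]_2) (f : 'cV[R]_2 -> 'cV[R]_2)
  (a b c t s : R).

Lemma cvg_mx {T : Type} {F : set_system T} {FF : Filter F} m n
    (M : T -> 'M[R]_(m, n)) (N : 'M[R]_(m, n)) :
  (forall i j, M x i j @[x --> F] --> N i j) -> M x @[x --> F] --> N.
Proof.
move=> MN; apply/cvgrPdist_le => e e0; near=> x.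
rewrite /Num.Def.normr /= mx_normrE (bigmax_le _ (ltW e0))//= => i _.
rewrite !mxE/=.
move: i; near: x; apply: filter_forall => /= i.
exact: ((cvgrPdist_le _ _).1 (MN i.1 i.2)).
Unshelve. all: by end_near. Qed.

Lemma derive_grad f y w : differentiable f y -> 'D_w f y = grad f y *m w.
Proof.
move=> df; rewrite deriveE //.
have {1}-> : w = w 0 0 *: delta_mx 0 0 + w 1 0 *: delta_mx 1 0.
  by apply: cv2P; rewrite !mxE /=; ring.
apply/colP => i; rewrite linearD !linearZ /= !mulmx2E !mxE !deriveE // /grad.
by congr (_ + _); rewrite mulrC.
Qed.

Lemma is_derive_line f y w t : differentiable f (y + t *: w) ->
  is_derive t 1 (fun s => f (y + s *: w)) (grad f (y + t *: w) *m w).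
Proof.
move=> df; rewrite -derive_grad //.
have E : (fun h => h^-1 *: (((fun s => f (y + s *: w)) \o shift t) (h *: 1)
                              - f (y + t *: w)))
    = (fun h => h^-1 *: ((f \o shift (y + t *: w)) (h *: w) - f (y + t *: w))).
  apply/funext => h /=; rewrite [h *: 1]mulr1 scalerDl.
  by congr (_ *: (f _ - _)); rewrite addrCA addrC -addrA.
split; first by rewrite /derivable E; exact: diff_derivable.
by rewrite /derive E.
Qed.

Lemma is_derive_mxE m n (f : R -> 'M[R]_(m, n)) (t : R) (D : 'M[R]_(m, n)) i j :
  is_derive t 1 f D -> is_derive t 1 (fun s => f s i j) (D i j).
Proof.
move=> [df <-]; split; first exact: (derivable_mxP _ _ _).1.
by rewrite derive_mx // mxE.
Qed.

(** Mean value theorem along the segment, coordinate by coordinate. *)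
Lemma grad_increment f (G : 'M[R]_2) y w : continuous f ->
  (forall t, 0 < t < 1 ->
     differentiable f (y + t *: w) /\ grad f (y + t *: w) = G) ->
  f (y + w) = f y + G *m w.
Proof.
move=> cf df; apply/colP => i; rewrite mxE.
pose g s := f (y + s *: w) i 0.
have gc : continuous g.
  move=> s; apply: (continuous_comp _ (@coord_continuous _ _ _ i 0 _)).
  apply: (continuous_comp _ (cf _)).
  by apply: cvgD; [exact: cvg_cst|apply: cvgZl; exact: cvg_id].
have [] := @MVT R g (fun=> (G *m w) i 0) 0 1 ltr01.
- move=> t; rewrite in_itv /= => t01; have [dft Gt] := df t t01.
  by apply: is_derive_mxE; rewrite -Gt; exact: is_derive_line.
- exact: continuous_subspaceT.
- by move=> c _; rewrite /g scale1r scale0r !addr0 subr0 mulr1 => /eqP;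
    rewrite subr_eq addrC => /eqP.
Qed.

(** By [grad_increment] along the segments from the vertices, f p - f V is
    G (p - V) for each vertex V; averaging over the vertices with the
    barycentric coordinates of p eliminates G. *)
Lemma affine_on_triangle f (G : 'M[R]_2) A B C a b c : continuous f ->
  (forall x, open_triangle A B C x -> differentiable f x /\ grad f x = G) ->
  0 < a -> 0 < b -> 0 < c -> a + b + c = 1 ->
  f (a *: A + b *: B + c *: C) = a *: f A + b *: f B + c *: f C.
Proof.
move=> cf df a0 b0 c0 abc; set p := a *: A + _ + _.
have Tp : open_triangle A B C p by exists a, b, c.
(* the half-open segment from p to a vertex stays inside the triangle *)
have seg V : (exists a' b' c', [/\ 0 <= a', 0 <= b', 0 <= c', a' + b' + c' = 1
      & V = a' *: A + b' *: B + c' *: C]) ->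
    f p = f V + G *m (p - V).
  move=> [a' [b' [c' [a'0 b'0 c'0 abc' ->]]]].
  set V' := _ + c' *: C; rewrite -[in LHS](subrKC V' p).
  apply: grad_increment => // t /andP[t0 t1]; apply: df.
  exists ((1 - t) * a' + t * a), ((1 - t) * b' + t * b), ((1 - t) * c' + t * c).
  split.
  - by rewrite ltr_wpDl ?mulr_ge0 ?mulr_gt0 // subr_ge0 ltW.
  - by rewrite ltr_wpDl ?mulr_ge0 ?mulr_gt0 // subr_ge0 ltW.
  - by rewrite ltr_wpDl ?mulr_ge0 ?mulr_gt0 // subr_ge0 ltW.
  - transitivity ((1 - t) * (a' + b' + c') + t * (a + b + c)); first by ring.
    by rewrite abc abc'; ring.
  - by rewrite /V' /p; apply: cv2P; rewrite !mxE; ring.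
have eA : f p = f A + G *m (p - A).
  apply: seg; exists 1, 0, 0; split=> //; rewrite ?addr0 //;
    by rewrite !scale0r !addr0 scale1r.
have eB : f p = f B + G *m (p - B).
  apply: seg; exists 0, 1, 0; split=> //; rewrite ?add0r ?addr0 //;
    by rewrite !scale0r addr0 add0r scale1r.
have eC : f p = f C + G *m (p - C).
  apply: seg; exists 0, 0, 1; split=> //; rewrite ?add0r //;
    by rewrite !scale0r !add0r scale1r.
rewrite -[LHS]scale1r -abc !scalerDl {1}eA {1}eB eC.
have p0 : a *: (p - A) + b *: (p - B) + c *: (p - C) = 0.
  have cE : c = 1 - a - b by rewrite -abc; ring.
  rewrite /p cE.
  by apply: cv2P; rewrite !mxE; ring.
rewrite !scalerDr !scalemxAr !(addrACA _ (G *m _)).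
by rewrite -mulmxDr addrACA -mulmxDr p0 mulmx0 addr0.
Qed.

(** * Barycentric coordinates of a moving triangle *)

Lemma perp0 v : perp v 0 0 = - v 1 0.
Proof. by rewrite /perp mulmx2E !mxE /= cos_pihalf sin_pihalf; ring. Qed.

Lemma perp1 v : perp v 1 0 = v 0 0.
Proof. by rewrite /perp mulmx2E !mxE /= cos_pihalf sin_pihalf; ring. Qed.

Lemma rotation_mul t v : rotation t *m v = cos t *: v + sin t *: perp v.
Proof.
have := perp0 v; have := perp1 v; move: (perp v) => w w1 w0.
by apply: cv2P; rewrite mulmx2E !mxE /= ?w0 ?w1; ring.
Qed.

Lemma continuous_perp : continuous (@perp R).
Proof.
move=> v; apply: (@cvg_mx _ (nbhs v)) => i j; rewrite (ord1 j).
case: (unliftP 0 i) => [k|] ->.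
  rewrite (ord1 k) (_ : lift 0 0 = 1); last exact/val_inj.
  under eq_fun do rewrite perp1.
  rewrite perp1; exact: coord_continuous.
under eq_fun do rewrite perp0.
rewrite perp0; apply: cvgN; exact: coord_continuous.
Qed.

Definition cross v w : R := v 0 0 * w 1 0 - v 1 0 * w 0 0.

(** Cramer's rule for the barycentric coordinate of x at the vertex A; unlike
    the weights in [open_triangle], it depends explicitly and continuously on
    the vertices. *)
Definition bary A B C x : R := cross (B - x) (C - x) / cross (B - A) (C - A).

Lemma cross_cvg {T : Type} {F : set_system T} {FF : Filter F}
    (f g : T -> 'cV[R]_2) v w :
  f x @[x --> F] --> v -> g x @[x --> F] --> w ->
  cross (f x) (g x) @[x --> F] --> cross v w.
Proof.
move=> fv gw; have coord (h : T -> 'cV[R]_2) (u : 'cV[R]_2) i :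
    h x @[x --> F] --> u -> h x i 0 @[x --> F] --> u i 0.
  by move=> hu; exact: (cvg_comp _ _ hu (@coord_continuous R 2 1 i 0 u)).
by apply: cvgB; apply: cvgM; apply: coord.
Qed.

Lemma bary_cvg {T : Type} {F : set_system T} {FF : Filter F}
    (A B C X : T -> 'cV[R]_2) (a b c x : 'cV[R]_2) :
  cross (b - a) (c - a) != 0 ->
  A z @[z --> F] --> a -> B z @[z --> F] --> b -> C z @[z --> F] --> c ->
  X z @[z --> F] --> x ->
  bary (A z) (B z) (C z) (X z) @[z --> F] --> bary a b c x.
Proof.
move=> nz Aa Bb Cc Xx; apply: cvgM; first by apply: cross_cvg; apply: cvgB.
by apply: cvgV => //; apply: cross_cvg; apply: cvgB.
Qed.

Lemma cross_cycle A B C : cross (C - B) (A - B) = cross (B - A) (C - A).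
Proof. by rewrite /cross !mxE; ring. Qed.

Lemma bary_sum A B C x : cross (B - A) (C - A) != 0 ->
  bary A B C x + bary B C A x + bary C A B x = 1.
Proof.
move=> nz; rewrite /bary (cross_cycle A B C) -(cross_cycle C A B).
by move: nz; rewrite /cross !mxE => nz; field.
Qed.

Lemma bary_comb A B C x : cross (B - A) (C - A) != 0 ->
  x = bary A B C x *: A + bary B C A x *: B + bary C A B x *: C.
Proof.
move=> nz; rewrite /bary (cross_cycle A B C) -(cross_cycle C A B).
by move: nz; rewrite /cross !mxE => nz; apply: cv2P; rewrite !mxE; field.
Qed.

Lemma bary_comb_val A B C a b c : cross (B - A) (C - A) != 0 ->
  a + b + c = 1 -> bary A B C (a *: A + b *: B + c *: C) = a.
Proof.
move=> nz abc; have -> : a = 1 - b - c by rewrite -abc; ring.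
by rewrite /bary; move: nz; rewrite /cross !mxE => nz; field.
Qed.

Lemma open_triangle_cycle A B C : open_triangle A B C = open_triangle B C A.
Proof.
by apply/seteqP; split=> x [a [b [c [a0 b0 c0 abc ->]]]];
  [exists b, c, a|exists c, a, b]; split=> //; [rewrite -abc| |rewrite -abc|];
  rewrite ?addrA 1?addrC ?addrA // addrC addrA.
Qed.

Lemma open_triangleE A B C x : cross (B - A) (C - A) != 0 ->
  open_triangle A B C x <->
  [/\ 0 < bary A B C x, 0 < bary B C A x & 0 < bary C A B x].
Proof.
move=> nz; split.
  have nz' := nz; rewrite -cross_cycle in nz'.
  have nz'' := nz'; rewrite -cross_cycle in nz''.
  move=> [a [b [c [a0 b0 c0 abc ->]]]]; split.
  - by rewrite bary_comb_val.
  - rewrite -addrA addrC bary_comb_val //; last by rewrite -abc; ring.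
  - rewrite addrC addrA bary_comb_val //; last by rewrite -abc; ring.
move=> [a0 b0 c0]; exists (bary A B C x), (bary B C A x), (bary C A B x).
by split=> //; [exact: bary_sum|exact: bary_comb].
Qed.

(** Used both for a fixed point in a moving triangle, and for a moving point
    in a fixed triangle, that is for the openness of the triangle. *)
Lemma open_triangle_near {T : Type} {F : set_system T} {FF : Filter F}
    (A B C X : T -> 'cV[R]_2) (a b c x : 'cV[R]_2) :
  cross (b - a) (c - a) != 0 ->
  A z @[z --> F] --> a -> B z @[z --> F] --> b -> C z @[z --> F] --> c ->
  X z @[z --> F] --> x -> open_triangle a b c x ->
  \forall z \near F, open_triangle (A z) (B z) (C z) (X z).
Proof.
move=> nz Aa Bb Cc Xx.
have nz' := nz; rewrite -cross_cycle in nz'.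
have nz'' := nz'; rewrite -cross_cycle in nz''.
move=> /(open_triangleE _ _ _ _ nz)[a0 b0 c0].
have dA := bary_cvg _ _ _ _ _ _ _ _ nz Aa Bb Cc Xx.
have dB := bary_cvg _ _ _ _ _ _ _ _ nz' Bb Cc Aa Xx.
have dC := bary_cvg _ _ _ _ _ _ _ _ nz'' Cc Aa Bb Xx.
have dD : cross (B z - A z) (C z - A z) @[z --> F] --> cross (b - a) (c - a).
  by apply: cross_cvg; apply: cvgB.
near=> z.
apply/open_triangleE.
  near: z; exact: (cvgr_neq0 _ dD).
split.
- by near: z; exact: (cvgr_gt _ (dA _) _ a0).
- by near: z; exact: (cvgr_gt _ (dB _) _ b0).
- by near: z; exact: (cvgr_gt _ (dC _) _ c0).
Unshelve. all: by end_near. Qed.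

End Triangles.

(** * Velocity of an interpolation between rotating vertices *)

Section Interpolation.
Context {R : realType}.
Implicit Types (v w x y : 'cV[R]_2) (a b c s t : R).

(** A product rule in which g is only continuous: as f vanishes at t, the
    variation of g does not contribute to first order. *)
Lemma is_derive_vanishing_scale (W : normedModType R) (f : R -> R) (g : R -> W)
    (t df : R) :
  f t = 0 -> is_derive t 1 f df -> g s @[s --> t] --> g t ->
  is_derive t 1 (fun s => f s *: g s) (df *: g t).
Proof.
move=> f0 fdf gc.
have qE : (fun h => h^-1 *: (((fun s => f s *: g s) \o shift t) (h *: 1)
                              - f t *: g t))
    = (fun h => (h^-1 *: ((f \o shift t) (h *: 1) - f t)) *: g (h + t)).
  by apply/funext => h /=; rewrite f0 scale0r !subr0 [h *: 1]mulr1 scalerA.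
have lim_q : h^-1 *: (((fun s => f s *: g s) \o shift t) (h *: 1) - f t *: g t)
    @[h --> 0^'] --> df *: g t.
  rewrite qE; apply: cvgZ.
    by have <- := derive_val (is_derive := fdf); exact: ex_derive.
  apply: cvg_within_filter.
  have : h + t @[h --> (0:R)] --> 0 + t.
    by apply: cvgD; [exact: cvg_id|exact: cvg_cst].
  by rewrite add0r => ht; exact: (cvg_comp _ _ ht gc).
by split; [apply/cvg_ex; exists (df *: g t)|exact: cvg_lim].
Qed.

Lemma is_derive_rotating (g : R -> 'cV[R]_2) (k t : R) :
  g s @[s --> t] --> g t ->
  is_derive t 1 (fun s => rotation (k * (s - t)) *m g s - g s)
    (k *: perp (g t)).
Proof.
move=> gc.
have -> : (fun s => rotation (k * (s - t)) *m g s - g s)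
    = (fun s => (cos (k * (s - t)) - 1) *: g s)
      + (fun s => sin (k * (s - t)) *: perp (g s)).
  apply/funext => s; rewrite rotation_mul fctE.
  by move: (perp (g s)) => w; apply: cv2P; rewrite !mxE; ring.
have dk : is_derive t 1 (fun s => k * (s - t)) k.
  by apply: is_derive_eq; rewrite /= subr0 [LHS]mulr1.
have -> : k *: perp (g t) = 0 *: g t + k *: perp (g t).
  by rewrite scale0r add0r.
apply: is_deriveD.
  apply: is_derive_vanishing_scale => //.
    by rewrite subrr mulr0 cos0 subrr.
  have dc := @is_derive1_comp R cos (fun s => k * (s - t)) t _ k
    (is_derive_cos _) dk.
  have := is_deriveB dc (@is_derive_cst R R R 1 t 1).
  by rewrite subrr mulr0 sin0 oppr0 mul0r addr0.
apply: is_derive_vanishing_scale.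
- by rewrite subrr mulr0 sin0.
- have := @is_derive1_comp R sin (fun s => k * (s - t)) t _ k
    (is_derive_sin _) dk.
  by rewrite subrr mulr0 cos0 mul1r.
- exact: (cvg_comp _ _ gc (@continuous_perp R _)).
Qed.

(** Since x itself is the interpolation of the vertices, f s x - x is the sum of
    the rotation defects of the weighted vertices.  These defects vanish at
    s = t, so by [is_derive_rotating] the motion of the vertices and of the
    weights is irrelevant: only their continuity matters. *)
Lemma interpolation_velocity (f : R -> 'cV[R]_2 -> 'cV[R]_2)
    (A B C : R -> 'cV[R]_2) (ka kb kc t : R) x :
  cross (B t - A t) (C t - A t) != 0 ->
  A s @[s --> t] --> A t -> B s @[s --> t] --> B t -> C s @[s --> t] --> C t ->
  (\forall s \near t, forall a b c, 0 < a -> 0 < b -> 0 < c -> a + b + c = 1 ->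
     f s (a *: A s + b *: B s + c *: C s)
     = rotation (ka * (s - t)) *m (a *: A s)
       + rotation (kb * (s - t)) *m (b *: B s)
       + rotation (kc * (s - t)) *m (c *: C s)) ->
  forall a b c, 0 < a -> 0 < b -> 0 < c -> a + b + c = 1 ->
    x = a *: A t + b *: B t + c *: C t ->
  is_derive t 1 (fun s => f s x)
    (ka *: perp (a *: A t) + kb *: perp (b *: B t) + kc *: perp (c *: C t)).
Proof.
move=> nz Ac Bc Cc interp a b c a0 b0 c0 abc xE.
have nz' := nz; rewrite -cross_cycle in nz'.
have nz'' := nz'; rewrite -cross_cycle in nz''.
have Tx : open_triangle (A t) (B t) (C t) x by exists a, b, c.
pose la s := bary (A s) (B s) (C s) x *: A s.
pose lb s := bary (B s) (C s) (A s) x *: B s.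
pose lc s := bary (C s) (A s) (B s) x *: C s.
have laE : la t = a *: A t by rewrite /la xE bary_comb_val.
have lbE : lb t = b *: B t.
  by rewrite /lb xE -addrA addrC bary_comb_val // -abc; ring.
have lcE : lc t = c *: C t.
  by rewrite /lc xE addrC addrA bary_comb_val // -abc; ring.
have xc : x @[s --> t] --> x by exact: cvg_cst.
rewrite -laE -lbE -lcE.
pose drift k (l : R -> 'cV[R]_2) s := rotation (k * (s - t)) *m l s - l s.
have drift_derive k (l : R -> 'cV[R]_2) : l s @[s --> t] --> l t ->
  is_derive t 1 (drift k l) (k *: perp (l t)) by exact: is_derive_rotating.
have da : is_derive t 1 (drift ka la) (ka *: perp (la t)).
  by apply: drift_derive; apply: cvgZ => //; apply: bary_cvg.
have db : is_derive t 1 (drift kb lb) (kb *: perp (lb t)).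
  by apply: drift_derive; apply: cvgZ => //; apply: bary_cvg.
have dc : is_derive t 1 (drift kc lc) (kc *: perp (lc t)).
  by apply: drift_derive; apply: cvgZ => //; apply: bary_cvg.
have dsum := is_deriveD (is_deriveD (is_deriveD (is_derive_cst x t 1) da) db) dc.
rewrite -[ka *: _]add0r; apply: near_eq_is_derive dsum.
have Tnear : \forall s \near t, open_triangle (A s) (B s) (C s) x.
  exact: (open_triangle_near A B C (cst x) _ _ _ _ nz Ac Bc Cc xc Tx).
have nznear : \forall s \near t, cross (B s - A s) (C s - A s) != 0.
  have cc : cross (B s - A s) (C s - A s) @[s --> t]
      --> cross (B t - A t) (C t - A t) by apply: cross_cvg; apply: cvgB.
  exact: (cvgr_neq0 _ cc).
near=> s.
have interp_s := near interp s.
have nzs : cross (B s - A s) (C s - A s) != 0 by near: s.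
have /(open_triangleE _ _ _ _ nzs) [p q r] :
  open_triangle (A s) (B s) (C s) x by near: s.
have xs := bary_comb _ _ _ x nzs; rewrite -/(la s) -/(lb s) -/(lc s) in xs.
have -> : f s x = rotation (ka * (s - t)) *m la s
    + rotation (kb * (s - t)) *m lb s + rotation (kc * (s - t)) *m lc s.
  by rewrite {1}xs interp_s //; exact: bary_sum.
rewrite !fctE /drift {1}xs.
move: (rotation _ *m la s) (rotation _ *m lb s) (rotation _ *m lc s) => p1 q1 r1.
by apply: cv2P; rewrite !mxE; ring.
Unshelve. all: by end_near. Qed.

Lemma near_affine_grad (f : 'cV[R]_2 -> 'cV[R]_2) (G : 'M[R]_2) x v :
  (\forall y \near x, f y = G *m y + v) -> differentiable f x /\ grad f x = G.
Proof.
move=> fE; have Gc : continuous (mulmx G : 'cV[R]_2 -> 'cV[R]_2).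
  move=> y; apply: (@cvg_mx _ _ (nbhs y)) => i j; rewrite mulmx2E.
  under eq_fun do rewrite mulmx2E.
  by apply: cvgD; (apply: cvgM; [exact: cvg_cst|exact: coord_continuous]).
pose V : normedModType R := 'cV[R]_2.
pose dG : {linear V -> V} := mulmx G.
have fo : (f : V -> V) \o shift (x : V) = cst (f x : V) + dG +o_ (0 : V) id.
  have fE0 := fE; rewrite (near_shift (0 : V)) subr0 in fE0.
  apply/eqaddoP => e e0; near=> h.
  rewrite /= !fctE /= (nbhs_singleton fE).
  have -> : f (h + x) = G *m (h + x) + v.
    by near: h; exact: fE0.
  rewrite mulmxDr.
  rewrite [X in `|X|](_ : _ = 0) ?normr0 ?mulr_ge0 ?(ltW e0)//.
  by apply: cv2P; rewrite !mxE; ring.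
have dE := @diff_unique _ V V f dG x Gc fo.
have df : differentiable f x.
  by apply/diff_locallyP; rewrite dE.
split=> //; apply/matrixP => i j; rewrite mxE deriveE // dE.
by rewrite /dG /= -colE mxE.
Unshelve. all: by end_near. Qed.

End Interpolation.

(** * The isosceles triangle *)

Section Isosceles.
Context {R : realType}.
Implicit Types (v w x y : 'cV[R]_2) (a b c s t p q h : R).

Definition dir t : 'cV[R]_2 := rotation t *m e1 R.

Lemma dir0 t : dir t 0 0 = cos t.
Proof. by rewrite /dir mulmx2E !mxE /=; ring. Qed.

Lemma dir1 t : dir t 1 0 = sin t.
Proof. by rewrite /dir mulmx2E !mxE /=; ring. Qed.

Lemma isosceles_cross p q h t :
  cross (q *: dir (t - h) - p *: dir t) (q *: dir (t + h) - p *: dir t)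
  = 2 * (q * sin h) * (q * cos h - p).
Proof.
have tt := cos2Dsin2 t.
have coord k l u : (k *: dir l - p *: dir t) u 0 = k * dir l u 0 - p * dir t u 0.
  by rewrite !mxE.
rewrite /cross !coord !dir0 !dir1 !(cosB, sinB, cosD, sinD).
transitivity (2 * (q * sin h) * (q * cos h - p) * (cos t ^+ 2 + sin t ^+ 2)).
  by ring.
by rewrite tt mulr1.
Qed.

(** The infinitesimal rotation is skew.  In complex notation, with
    m = exp (i t), the symmetric part of the shear corresponds to
    i m^2 / 2. *)
Lemma sym_shear k c t :
  sym (k *: rotation (pi / 2) + c *: (perp (dir t) *m (dir t)^T))
  = (c / 2) *: reflection (pi / 2 + 2 * t).
Proof.
have -> : 2 * t = t + t by ring.
have d0 := dir0 t; have d1 := dir1 t.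
have p0 := perp0 (dir t); have p1 := perp1 (dir t).
rewrite d0 in p1; rewrite d1 in p0.
move: (perp (dir t)) p0 p1 => p p0 p1; move: (dir t) d0 d1 => m d0 d1.
apply: mx2P; rewrite !mxE !big_ord_recl !big_ord0 !mxE /= ?p0 ?p1 ?d0 ?d1.
all: by rewrite !(cosD, sinD) cos_pihalf sin_pihalf; field.
Qed.

(* The angular velocity is ka at the apex, and kb at both ends of the base. *)
Section IsoscelesVelocity.
Variables (f : R -> 'cV[R]_2 -> 'cV[R]_2) (A B C : R -> 'cV[R]_2).
Variables (ka kb t0 p q h t : R).
Hypotheses (A0 : A t0 = p *: dir t) (B0 : B t0 = q *: dir (t - h))
  (C0 : C t0 = q *: dir (t + h)).
Hypotheses (qh_neq0 : q * sin h != 0) (pq_neq0 : p - q * cos h != 0).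
Hypotheses (Ac : A s @[s --> t0] --> A t0) (Bc : B s @[s --> t0] --> B t0)
  (Cc : C s @[s --> t0] --> C t0).
Hypothesis interp : \forall s \near t0,
  forall a b c, 0 < a -> 0 < b -> 0 < c -> a + b + c = 1 ->
    f s (a *: A s + b *: B s + c *: C s)
    = rotation (ka * (s - t0)) *m (a *: A s)
      + rotation (kb * (s - t0)) *m (b *: B s)
      + rotation (kb * (s - t0)) *m (c *: C s).

Let g := p * (ka - kb) / (p - q * cos h).

Lemma isosceles_nondegenerate : cross (B t0 - A t0) (C t0 - A t0) != 0.
Proof.
rewrite A0 B0 C0 isosceles_cross; apply: mulf_neq0.
  by apply: mulf_neq0; rewrite ?pnatr_eq0.
by rewrite -oppr_eq0 opprB.
Qed.

(** After subtracting kb y^perp, the velocity vanishes on the base and is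
    (ka - kb) p m^perp at the apex, so it is proportional to the distance of y
    to the base, the line at distance q cos h from the origin. *)
Lemma isosceles_is_derive y : open_triangle (A t0) (B t0) (C t0) y ->
  is_derive t0 1 (fun s => f s y)
    ((kb *: rotation (pi / 2) + g *: (perp (dir t) *m (dir t)^T)) *m y
     - (g * (q * cos h)) *: perp (dir t)).
Proof.
move=> [a [b [c [a0 b0 c0 abc yE]]]].
have := interpolation_velocity f A B C ka kb kb t0 y isosceles_nondegenerate
  Ac Bc Cc interp a b c a0 b0 c0 abc yE.
set D := (X in is_derive _ _ _ X -> _); set D' := (X in _ -> is_derive _ _ _ X).
suff -> : D = D' by [].
have m_y : (dir t)^T *m y = (a * p + (1 - a) * (q * cos h))%:M.
  have cE : c = 1 - a - b by rewrite -abc; ring.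
  have coord u : y u 0 = a * (p * dir t u 0) + b * (q * dir (t - h) u 0)
      + c * (q * dir (t + h) u 0) by rewrite yE A0 B0 C0 !mxE.
  apply/matrixP => i j; rewrite (ord1 i) (ord1 j) mulmx2E !coord.
  rewrite [_^T _ _]mxE [_^T _ 1]mxE [RHS]mxE /= mulr1n !dir0 !dir1.
  rewrite !(cosB, sinB, cosD, sinD).
  transitivity ((a * p + (b + c) * (q * cos h)) * (cos t ^+ 2 + sin t ^+ 2)).
    by ring.
  by rewrite cos2Dsin2 mulr1 cE; ring.
rewrite /D' mulmxDl -!scalemxAl -mulmxA m_y mul_mx_scalar -/(perp y).
have perpD u v : perp (u + v) = perp u + perp v by exact: mulmxDr.
have perpZ k v : perp (k *: v) = k *: perp v by rewrite /perp -scalemxAr.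
rewrite /D [in RHS]yE A0 !(perpD, perpZ).
have -> : c = 1 - a - b by rewrite -abc; ring.
move: (perp (dir t)) (perp (B t0)) (perp (C t0)) => u v w.
by apply: cv2P; rewrite !mxE /g; field.
Qed.

Lemma isosceles_strain x : open_triangle (A t0) (B t0) (C t0) x ->
  [/\ derivable (fun s => f s x) t0 1,
      differentiable (fun y => derive1 (fun s => f s y) t0) x
    & sym (grad (fun y => derive1 (fun s => f s y) t0) x)
      = (g / 2) *: reflection (pi / 2 + 2 * t)].
Proof.
move=> Tx; have dx := isosceles_is_derive x Tx.
have [] := @near_affine_grad R (fun y => derive1 (fun s => f s y) t0)
  (kb *: rotation (pi / 2) + g *: (perp (dir t) *m (dir t)^T)) x
  (- ((g * (q * cos h)) *: perp (dir t))).
  have cstc (V : 'cV[R]_2) : V @[_ --> nbhs x] --> V.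
    exact: (@cvg_cst _ V _ (nbhs x) _).
  have : \forall y \near nbhs x, open_triangle (A t0) (B t0) (C t0) y.
    exact: (open_triangle_near (fun=> A t0) (fun=> B t0) (fun=> C t0) id
      _ _ _ _ isosceles_nondegenerate (cstc _) (cstc _) (cstc _) cvg_id Tx).
  apply: (@filterS _ (nbhs x)) => y /isosceles_is_derive dy.
  rewrite derive1E; exact: (@derive_val _ _ _ _ _ _ _ dy).
by move=> dv -> ; split; [exact: ex_derive|exact: dv|exact: sym_shear].
Qed.

End IsoscelesVelocity.
End Isosceles.

(** * The maps of the construction *)

Section ContiMap.
Context {R : realType} (n : nat) (n_ge3 : (3 <= n)%N).
Implicit Types (f : 'cV[R]_2 -> 'cV[R]_2) (alpha s t : R).

Let n_neq0 : n%:R != 0 :> R.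
Proof. by rewrite pnatr_eq0 -lt0n (leq_trans _ n_ge3). Qed.

Lemma locally_lipschitz_continuous f : locally_lipschitz f -> continuous f.
Proof.
move=> lip x; have [V Vx [M [Mreal HM]]] := lip x.
have {HM} [k k0 HM] : exists2 k : R, 0 < k &
    forall y, V y -> `|f x - f y| <= k * `|x - y|.
  exists (Num.max M 0 + 1); first by rewrite ltr_wpDl // le_max lexx orbT.
  have Mlt : M < Num.max M 0 + 1 by rewrite ltr_pwDr // le_max lexx.
  by move=> y Vy; apply: (HM _ Mlt (x, y)); split=> //; exact: nbhs_singleton.
apply/(@cvgrPdist_le _ _ _ (nbhs x)) => e e0.
have close : \forall y \near nbhs x, `|x - y| <= e / k.
  have idc : y @[y --> nbhs x] --> x by exact: cvg_id.
  by apply: ((cvgrPdist_le _ _).1 idc); rewrite divr_gt0.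
apply: (@filterS2 _ (nbhs x) _ _ _ _ _ Vx close) => y Vy xy.
by rewrite (le_trans (HM y Vy)) // -ler_pdivlMl // mulrC.
Qed.

Lemma E_ptE k : E_pt R n k = dir (2 * pi / n%:R * (k%:R - 1)).
Proof. by []. Qed.

Lemma I_ptE alpha k :
  I_pt n alpha k = r_I n alpha *: dir (2 * pi / n%:R * (k%:R - 1 + alpha)).
Proof. by []. Qed.

Lemma dirD2pi t : dir (t + 2 * pi) = dir t.
Proof.
apply: cv2P; rewrite !(dir0, dir1).
  by rewrite -(cosD2pin t 1) mulr1.
by rewrite -(sinD2pin t 1) mulr1.
Qed.

Lemma I_pt_periodic alpha k : I_pt n alpha (k + n) = I_pt n alpha k.
Proof.
rewrite !I_ptE -[in RHS]dirD2pi; congr (_ *: dir _).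
by rewrite natrD; field.
Qed.

(** The polygon lies in the unit disc, hence in the half-planes that
    support the disc. *)
Lemma Omega_E_dir_le1 x t : Omega_E n x -> (x 0 0) * cos t + x 1 0 * sin t <= 1.
Proof.
move=> [w [w0 w1 ->]].
rewrite !summxE !mulr_suml -big_split /= -w1; apply: ler_sum => i _.
have coord k (v : 'cV[R]_2) u : (k *: v) u 0 = k * v u 0 by rewrite mxE.
rewrite E_ptE !coord dir0 dir1 -!mulrA -mulrDr.
by rewrite -cosB ler_piMr // cos_le1.
Qed.

(** The points s E_k with s > 1 lie outside the polygon, where the map is the
    identity; let s tend to 1. *)
Lemma conti_map_E_pt alpha f k : is_conti_map n alpha f ->
  f (E_pt R n k) = E_pt R n k.
Proof.
move=> [/locally_lipschitz_continuous cf fout _ _].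
pose th : R := 2 * pi / n%:R * (k%:R - 1); rewrite E_ptE -/th.
pose g (s : R) := f (s *: dir th) - s *: dir th.
have gout s : 1 < s -> g s = 0.
  move=> s1; rewrite /g fout ?subrr // => /(@Omega_E_dir_le1 _ th).
  have coord k' (v : 'cV[R]_2) u : (k' *: v) u 0 = k' * v u 0 by rewrite mxE.
  rewrite !coord dir0 dir1 -!mulrA -mulrDr -!expr2 cos2Dsin2 mulr1.
  by rewrite leNgt s1.
have sc : s *: dir th @[s --> (1 : R)] --> 1 *: dir th.
  by apply: cvgZ; [exact: cvg_id|exact: cvg_cst].
have gc : g s @[s --> (1 : R)] --> g 1.
  by apply: cvgB => //; exact: (cvg_comp _ _ sc (cf _)).
have g0 : g s @[s --> (1 : R)^'+] --> (0 : 'cV[R]_2).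
  apply: cvg_near_cst; near=> s; apply: gout; near: s; exact: nbhs_right_gt.
have g10 : g 1 = 0.
  exact: (cvg_unique (@norm_hausdorff R 'cV[R]_2) (cvg_at_right_filter gc) g0).
apply/eqP; rewrite -subr_eq0 -[X in f X]scale1r -[X in _ - X]scale1r.
by rewrite -/(g 1) g10.
Unshelve. all: by end_near. Qed.

Lemma conti_map_I_pt alpha f k : (k <= n)%N -> is_conti_map n alpha f ->
  f (I_pt n alpha k) = Q n (1 - 2 * alpha) *m I_pt n alpha k.
Proof.
move=> kn [_ _ fin _]; apply: fin.
wlog k0 : k kn / (0 < k)%N.
  move=> H; case: (posnP k) => [->|]; last exact: H.
  by rewrite -(I_pt_periodic alpha 0); apply: H => //;
    rewrite add0n // (leq_trans _ n_ge3).
have kn' : (k.-1 < n)%N by rewrite prednK.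
exists (fun i => (i == Ordinal kn')%:R); split=> [i||].
- exact: ler0n.
- by rewrite (bigD1 (Ordinal kn')) //= eqxx big1 ?addr0 // => i /negPf ->.
- rewrite (bigD1 (Ordinal kn')) //= eqxx scale1r prednK // big1 ?addr0 //.
  by move=> i /negPf ->; rewrite scale0r.
Qed.

Lemma r_I_half : r_I n (1 / 2 : R) = (1 - sin (pi / n%:R)) / cos (pi / n%:R).
Proof.
have s0 := sin_pi_over_n_gt0 n n_ge3 (R := R).
rewrite /r_I (_ : pi / n%:R * (1 - _) = 0); last by field.
rewrite (_ : _ * (1 / 2) = pi / n%:R); last by field.
rewrite (_ : _ * (1 - 1 / 2) = pi / n%:R); last by field.
by rewrite cos0 -expr2 sqrtr_sqr gtr0_norm.
Qed.

Let cvg_affine (a b c : R) :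
  a * (b + c * alpha) @[alpha --> (1 / 2 : R)] --> a * (b + c * (1 / 2)).
Proof.
apply: cvgM; first exact: cvg_cst.
apply: cvgD; first exact: cvg_cst.
by apply: cvgM; [exact: cvg_cst|exact: cvg_id].
Qed.

Lemma r_I_continuous : r_I n alpha @[alpha --> (1 / 2 : R)] --> r_I n (1 / 2 : R).
Proof.
have cos_cvg a b c : cos (a * (b + c * alpha)) @[alpha --> (1 / 2 : R)]
    --> cos (a * (b + c * (1 / 2))).
  exact: (cvg_comp _ _ (cvg_affine a b c) (@continuous_cos R _)).
have sin_cvg a b c : sin (a * (b + c * alpha)) @[alpha --> (1 / 2 : R)]
    --> sin (a * (b + c * (1 / 2))).
  exact: (cvg_comp _ _ (cvg_affine a b c) (@continuous_sin R _)).
have cE alpha : r_I n alpha = (cos (pi / n%:R * (1 + (-2) * alpha))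
   - Num.sqrt (sin (2 * pi / n%:R * (0 + 1 * alpha))
               * sin (2 * pi / n%:R * (1 + (-1) * alpha))))
  / cos (pi / n%:R).
  by rewrite /r_I !mulNr add0r !mul1r.
rewrite cE; under eq_fun do rewrite cE.
apply: cvgM; last exact: cvg_cst.
apply: cvgB; first exact: cos_cvg.
have prod_cvg := cvgM (sin_cvg (2 * pi / n%:R) 0 1)
  (sin_cvg (2 * pi / n%:R) 1 (-1)).
exact: (cvg_comp _ _ (prod_cvg _) (@sqrt_continuous R _)).
Qed.

Lemma I_pt_continuous k :
  I_pt n alpha k @[alpha --> (1 / 2 : R)] --> I_pt n (1 / 2 : R) k.
Proof.
have dirE a t :
    a *: dir t = \col_i (a * if i == 0 then cos t else sin t) :> 'cV[R]_2.
  have coord u : (a *: dir t) u 0 = a * dir t u 0 by rewrite mxE.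
  by apply: cv2P; rewrite coord ?dir0 ?dir1 mxE.
rewrite I_ptE dirE; under eq_fun do rewrite I_ptE dirE.
apply: (@cvg_mx R) => i j; rewrite mxE; under eq_fun do rewrite mxE.
apply: cvgM; first exact: r_I_continuous.
have lin : 2 * pi / n%:R * (k%:R - 1 + alpha) @[alpha --> (1 / 2 : R)]
    --> 2 * pi / n%:R * (k%:R - 1 + 1 / 2).
  under eq_fun do rewrite -[X in _ + X]mul1r.
  by rewrite -[X in _ - 1 + X]mul1r; exact: cvg_affine.
case: ifP => _.
  exact: (cvg_comp _ _ lin (@continuous_cos R _)).
exact: (cvg_comp _ _ lin (@continuous_sin R _)).
Qed.

(** With h = pi / n and r = (1 - sin h) / cos h, these are the values that make
    the two kinds of triangles carry the same amount of shear. *)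
Lemma r_I_half_shear (r : R) : r = r_I n (1 / 2) ->
  [/\ r != 0, 1 - r * cos (pi / n%:R) = sin (pi / n%:R),
      r - cos (pi / n%:R) != 0
    & r / (r - cos (pi / n%:R)) = - (sin (pi / n%:R))^-1].
Proof.
have := sin_pi_over_n_gt0 n n_ge3 (R := R).
have := cos_pi_over_n_gt0 n n_ge3 (R := R).
have := cos2Dsin2 (pi / n%:R : R).
rewrite r_I_half; set c := cos _; set s := sin _ => cs c0 s0 ->.
have s1 : s < 1 by nra.
have cn : c != 0 by rewrite gt_eqF.
have sn : s != 0 by rewrite gt_eqF.
have s1n : 1 - s != 0 by rewrite subr_eq0 gt_eqF.
have rc : (1 - s) / c - c = - (s * (1 - s) / c).
  have c2 : c * c = 1 - s * s by rewrite -cs; ring.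
  by apply: (mulIf cn); rewrite mulrBl c2; field.
split.
- by rewrite mulf_neq0 ?invr_neq0.
- by rewrite divfK //; ring.
- by rewrite rc oppr_eq0 !mulf_neq0 ?invr_neq0.
- by rewrite rc; field; rewrite sn s1n cn.
Qed.

Section ContiVelocity.
Variable u : R -> 'cV[R]_2 -> 'cV[R]_2.
Hypothesis u_conti : forall alpha, 0 < alpha < 1 -> is_conti_map n alpha (u alpha).

Let h : R := pi / n%:R.

Lemma conti_interpolation j (A B C : R -> 'cV[R]_2) (ka kb kc : R) :
  (1 <= j <= n.*2)%N ->
  (forall s, T n s j = open_triangle (A s) (B s) (C s)) ->
  (forall s, 0 < s < 1 ->
     [/\ u s (A s) = rotation (ka * (s - 1 / 2)) *m A s,
         u s (B s) = rotation (kb * (s - 1 / 2)) *m B s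
       & u s (C s) = rotation (kc * (s - 1 / 2)) *m C s]) ->
  \forall s \near (1 / 2 : R),
    forall a b c, 0 < a -> 0 < b -> 0 < c -> a + b + c = 1 ->
    u s (a *: A s + b *: B s + c *: C s)
    = rotation (ka * (s - 1 / 2)) *m (a *: A s)
      + rotation (kb * (s - 1 / 2)) *m (b *: B s)
      + rotation (kc * (s - 1 / 2)) *m (c *: C s).
Proof.
move=> jn TE uV; near=> s => a b c a0 b0 c0 abc.
have s01 : 0 < s < 1.
  apply/andP; split; near: s.
    by apply: lt_nbhsr; lra.
  by apply: lt_nbhsl; lra.
have [uA uB uC] := uV s s01.
have [lip _ _ [R_E _ grad_u]] := u_conti s s01.
rewrite (affine_on_triangle (u s) (R_E^T *m U_ n s j) (A s) (B s) (C s)) //.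
- by rewrite uA uB uC !scalemxAr.
- exact: locally_lipschitz_continuous.
- by move=> x; rewrite -TE; exact: grad_u.
Unshelve. all: by end_near. Qed.

Lemma Q_rotation s : Q n (1 - 2 * s) = rotation (- (4 * h) * (s - 1 / 2)) :> 'M[R]_2.
Proof. by rewrite /Q /h; congr rotation; field. Qed.

Lemma fixed_rotation (s : R) (v : 'cV[R]_2) : v = rotation (0 * s) *m v.
Proof. by rewrite mul0r rotation_mul cos0 sin0 scale1r scale0r addr0. Qed.

(** The triangles with odd index have their apex at an outer vertex and their
    base between two inner ones; for even index the roles are exchanged. *)
Lemma conti_strain j x : (1 <= j <= n.*2)%N -> T n (1 / 2 : R) j x ->
  [/\ derivable (fun alpha => u alpha x) (1 / 2) 1,
      differentiable (v0 u) x
    & sym (grad (v0 u) x)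
      = (2 * h / sin h) *: reflection (pi / 2 + 2 * pi / n%:R * j.-1%:R)].
Proof.
move=> jn Tx; have [r0 r1 rc r2] := r_I_half_shear _ erefl.
have s0 : sin h != 0 by rewrite gt_eqF // sin_pi_over_n_gt0.
have uE k s : 0 < s < 1 ->
    u s (E_pt R n k) = rotation (0 * (s - 1 / 2)) *m E_pt R n k.
  by move=> s01; rewrite -fixed_rotation; exact: conti_map_E_pt (u_conti s s01).
have uI k s : (k <= n)%N -> 0 < s < 1 ->
    u s (I_pt n s k) = rotation (- (4 * h) * (s - 1 / 2)) *m I_pt n s k.
  by move=> kn s01; rewrite (conti_map_I_pt _ _ _ kn (u_conti s s01)) Q_rotation.
have Ec k : E_pt R n k @[s --> (1 / 2 : R)] --> E_pt R n k by exact: cvg_cst.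
case: (boolP (odd j)) => oj.
  pose k := j./2; have jE : j = k.*2.+1 by rewrite -[j]odd_double_half oj.
  have kn : (k < n)%N by lia.
  have TE s : T n s j = open_triangle (E_pt R n k.+1) (I_pt n s k) (I_pt n s k.+1).
    by rewrite /T oj jE /= doubleK.
  have interp := conti_interpolation j (fun=> E_pt R n k.+1) (fun s => I_pt n s k)
    (fun s => I_pt n s k.+1) 0 (- (4 * h)) (- (4 * h)) jn TE
    (fun s s01 => And3 (uE _ _ s01) (uI _ _ (ltnW kn) s01) (uI _ _ kn s01)).
  have [||||||dx dv ->] := isosceles_strain u (fun=> E_pt R n k.+1)
    (fun s => I_pt n s k) (fun s => I_pt n s k.+1) 0 (- (4 * h)) (1 / 2) 1
    (r_I n (1 / 2)) h (2 * h * k%:R) _ _ _ _ _ (Ec _) (I_pt_continuous _)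
    (I_pt_continuous _) interp x.
  - by rewrite E_ptE scale1r -(natr1 k) addrK; congr dir; rewrite /h; ring.
  - by rewrite I_ptE; congr (_ *: dir _); rewrite /h; field.
  - by rewrite I_ptE -(natr1 k); congr (_ *: dir _); rewrite /h; field.
  - by rewrite mulf_neq0.
  - by rewrite r1.
  - by rewrite -TE.
  split=> //; congr (_ *: reflection _).
    by rewrite r1; field.
  by rewrite jE /= -muln2 natrM /h; field.
pose k := j./2; have jE : j = k.*2 by rewrite -[j]odd_double_half (negPf oj).
have k0 : (0 < k)%N by lia.
have kn : (k <= n)%N by lia.
have TE s : T n s j = open_triangle (I_pt n s k) (E_pt R n k.+1) (E_pt R n k).
  by rewrite /T (negPf oj) open_triangle_cycle.
have interp := conti_interpolation j (fun s => I_pt n s k)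
  (fun=> E_pt R n k.+1) (fun=> E_pt R n k) (- (4 * h)) 0 0 jn TE
  (fun s s01 => And3 (uI _ _ kn s01) (uE _ _ s01) (uE _ _ s01)).
(* in the cyclic order used here the base is traversed in the opposite
   direction, hence the half-angle - h *)
have [||||||dx dv ->] := isosceles_strain u (fun s => I_pt n s k)
  (fun=> E_pt R n k.+1) (fun=> E_pt R n k) (- (4 * h)) 0 (1 / 2)
  (r_I n (1 / 2)) 1 (- h) (2 * h * (k%:R - 1 / 2)) _ _ _ _ _
  (I_pt_continuous _) (Ec _) (Ec _) interp x.
- by rewrite I_ptE; congr (_ *: dir _); rewrite /h; field.
- by rewrite E_ptE scale1r -(natr1 k); congr dir; rewrite /h; field.
- by rewrite E_ptE scale1r; congr dir; rewrite /h; field.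
- by rewrite mul1r sinN oppr_eq0.
- by rewrite cosN (mul1r (cos _)).
- by rewrite -TE.
split=> //; congr (_ *: reflection _).
  by rewrite cosN (mul1r (cos _)) subr0 (mulrAC _ (- (4 * h))) r2; field.
by rewrite jE -subn1 natrB ?double_gt0 // -muln2 natrM /h; field.
Qed.

End ContiVelocity.
End ContiMap.

(** * Counting the strains *)

Theorem lemma3p4 (R : realType) (n : nat) (n_ge3 : (3 <= n)%N) (n_odd : odd n) :
  (forall u : R -> 'cV[R]_2 -> 'cV[R]_2,
     (forall alpha : R, 0 < alpha < 1 -> is_conti_map n alpha (u alpha)) ->
     exists strain : nat -> 'M[R]_2,
       (forall j, (1 <= j <= n.*2)%N -> forall x, T n (1 / 2 : R) j x ->
          [/\ derivable (fun alpha => u alpha x) (1 / 2) 1,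
              differentiable (v0 u) x
            & sym (grad (v0 u) x) = strain j]) /\
       [set strain j | j in [set j | (1 <= j <= n.*2)%N]] #= `I_n) /\
  (K n : set 'M[R]_2) #= `I_n.
Proof.
have n0 : (0 < n)%N by exact: leq_trans n_ge3.
have s0 := sin_pi_over_n_gt0 n n_ge3 (R := R).
split; last first.
  rewrite K_orbit //; apply: reflection_orbit_card => //.
  by rewrite invr_eq0 gt_eqF // cos_pi_over_n_gt0.
move=> u u_conti.
pose a : R := 2 * (pi / n%:R) / sin (pi / n%:R).
pose t m : R := pi / 2 + 2 * pi / n%:R * m%:R.
exists (fun j => a *: reflection (t j.-1)); split.
  by move=> j jn x Tx; exact: conti_strain.
have a0 : a != 0.
  by rewrite gt_eqF // !mulr_gt0 ?invr_gt0 ?pi_gt0 ?ltr0n.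
suff -> : [set a *: reflection (t j.-1) | j in [set j | (1 <= j <= n.*2)%N]]
    = [set a *: reflection (t m) | m in `I_n].
  exact: reflection_orbit_card.
apply/seteqP; split=> _ [j jn <-].
  exists (j.-1 %% n)%N; first by rewrite /= ltn_mod.
  by rewrite reflection_modn.
by exists j.+1 => //=; move: (jn : (j < n)%N); lia.
Qed.
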